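(* Let $n\in\mathbb N\cup\{\infty\}$, let $k^i\ge 0$ ($1\le i\le n$) satisfy $\sum_i e^{-k^i}\le 1$, let $T\ge1$, let $s_1,\dots,s_T\in[0,1]^n$ be a fixed sequence of loss vectors, and let $\ell_{1:T}$ be the expected cumulative loss of the FPL (Follow the Perturbed Leader) algorithm run with learning rates $\eta_t>0$. (i) If $\eta_t=1/\sqrt t$ for all $t$, then $$\ell_{1:T}\le s_{1:T}^i+\sqrt T\,(k^i+2)\qquad\text{for all } i.$$ (ii) If $\eta_t=\sqrt{K/(2t)}$ for all $t$, where $K>0$ satisfies $k^i\le K$ for all $i$, then $$\ell_{1:T}\le s_{1:T}^i+2\sqrt{2TK}\qquad\text{for all } i.$$
   Context: Experts are indexed by $i$ with $1\le i\le n$ (all $i\in\mathbb N$ if $n=\infty$). $s_t^i\in[0,1]$ is the loss of expert $i$ at time $t$, $s_{1:t}^i=s_1^i+\dots+s_t^i$, $s_{<t}^i=s_1^i+\dots+s_{t-1}^i$ (so $s_{<1}^i=0$). The number $k^i$ is called the complexity of expert $i$. FPL: let $q=(q^i)_{1\le i\le n}$ have independent components, each exponentially distributed with rate 1 (density $e^{-x}$, $x\ge0$), drawn once at the beginning. At time $t$, FPL with learning rate $\eta_t$ selects the expert $$I_t=\arg\min_{i}\Big\{s_{<t}^i+\frac{k^i-q^i}{\eta_t}\Big\}$$ (the minimum is attained, uniquely, almost surely). Its expected loss at time $t$ is $\ell_t=E[s_t^{I_t}]$, and $\ell_{1:T}=\ell_1+\dots+\ell_T$. *)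

(* Defs.v *)
From HB Require Import structures.
From mathcomp Require Import all_boot all_order all_algebra finmap.
From mathcomp Require Import all_classical all_reals all_analysis.

Set Implicit Arguments.
Unset Strict Implicit.
Unset Printing Implicit Defensive.

Import Order.TTheory GRing.Theory Num.Theory.

Local Open Scope classical_set_scope.
Local Open Scope ring_scope.

(* The number of experts is in N U {oo}, with None standing for oo. Experts are
   numbered from 0; families over experts are functions on nat, of which only
   the values on [experts n] matter. *)
Definition experts (n : option nat) : set nat :=
  if n is Some m then `I_m else [set: nat].

(* Time starts at 1: s t i is the loss s_t^i of expert i at time t, t >= 1. *)
Definition loss_upto (R : realType) (s : nat -> nat -> R) (t i : nat) : R :=
  \sum_(1 <= u < t.+1) s u i.

Definition loss_before (R : realType) (s : nat -> nat -> R) (t i : nat) : R :=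
  \sum_(1 <= u < t) s u i.

Definition argmin_in (R : realType) (A : set nat) (f : nat -> R) : set nat :=
  [set i | A i /\ forall j, A j -> f i <= f j].

Definition mutually_independent (d : measure_display) (Omega : measurableType d)
    (R : realType) (P : probability Omega R) (A : set nat)
    (q : nat -> {RV P >-> R}) : Prop :=
  forall (J : {fset nat}) (B : nat -> set R),
    [set` J] `<=` A ->
    (forall i, i \in J -> measurable (B i)) ->
    P (\bigcap_(i in [set` J]) (q i @^-1` B i)) =
      (\prod_(i <- J) P (q i @^-1` B i))%E.

Definition exponential_perturbation (d : measure_display)
    (Omega : measurableType d) (R : realType) (P : probability Omega R)
    (n : option nat) (q : nat -> {RV P >-> R}) : Prop :=
  mutually_independent (experts n) q /\
  forall i, experts n i ->
    forall B : set R, measurable B ->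
      distribution P (q i) B = exponential_prob 1 B.

Definition FPL_score (R : realType) (k : nat -> R) (eta : nat -> R)
    (s : nat -> nat -> R) (q : nat -> R) (t i : nat) : R :=
  loss_before s t i + (k i - q i) / eta t.

(* I t is the expert I_t selected by FPL at time t. It is a random variable
   (nat carries the discrete sigma-algebra) which is a minimizer of the score
   at every outcome where the minimum is attained. This happens almost surely,
   and then the minimizer is almost surely unique; neither fact is assumed. At
   the remaining outcomes, and for breaking ties, the choice is arbitrary. *)
Definition FPL_selection (d : measure_display) (Omega : measurableType d)
    (R : realType) (P : probability Omega R) (n : option nat)
    (k : nat -> R) (eta : nat -> R) (s : nat -> nat -> R)
    (q : nat -> {RV P >-> R}) (T : nat) (I : nat -> {RV P >-> nat}) : Prop :=
  forall t, (1 <= t <= T)%N -> forall w : Omega,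
    let leaders :=
      argmin_in (experts n) (FPL_score k eta s (fun i => q i w) t) in
    experts n (I t w) /\ (leaders !=set0 -> leaders (I t w)).

Definition FPL_loss (d : measure_display) (Omega : measurableType d)
    (R : realType) (P : probability Omega R) (s : nat -> nat -> R)
    (I : nat -> {RV P >-> nat}) (t : nat) : \bar R :=
  'E_P[fun w => s t (I t w)]%E.

Definition FPL_loss_upto (d : measure_display) (Omega : measurableType d)
    (R : realType) (P : probability Omega R) (s : nat -> nat -> R)
    (I : nat -> {RV P >-> nat}) (T : nat) : \bar R :=
  (\sum_(1 <= t < T.+1) FPL_loss s I t)%E.

(* Main.v *)
(* FPL is compared with an infeasible algorithm that also sees the losses of
   time t, here replaced by the event that some expert leads by a gap of at
   least eta_t. By the memoryless property of the exponential distribution,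
   expert i leads with probability at most e^{eta_t} times the probability that
   it leads by the gap eta_t, whatever the other perturbations are. As losses lie
   in [0,1], this gives l_t <= eta_t + E g_t, where g_t is the loss of the gap
   leader (0 if there is none). A gap leader is still a leader after time t, so
   by induction on T, pointwise,
     g_1 + ... + g_T <= s_{1:T}^i + (k^i - q^i + M) / eta_T,
   where M = sum_j max(q^j - k^j, 0) is nonnegative and at least every
   q^j - k^j. In expectation M is at most sum_j e^{-k^j} <= 1 = E q^i, so the
   perturbation terms cancel, and sum_t 1 / sqrt t <= 2 sqrt T finishes. For
   infinitely many experts, the Kraft inequality and Borel-Cantelli ensure that
   the minimum is attained almost surely. *)

Require Import Defs.
From HB Require Import structures.
From mathcomp Require Import all_boot all_order all_algebra finmap.
From mathcomp Require Import all_classical all_reals all_analysis measurable_realfun.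
From mathcomp Require Import ring lra.

Set Implicit Arguments.
Unset Strict Implicit.
Unset Printing Implicit Defensive.

Import Order.TTheory GRing.Theory Num.Theory.
Import numFieldNormedType.Exports.

Local Open Scope classical_set_scope.
Local Open Scope ring_scope.

(** * Measurable comparisons and exponential random variables *)

Lemma measurable_le_set d (T : measurableType d) (R : realType) (f g : T -> R) :
  measurable_fun setT f -> measurable_fun setT g ->
  measurable [set x | f x <= g x].
Proof. by move=> mf mg; rewrite -[X in measurable X]setTI; exact: measurable_fun_le. Qed.

Lemma measurable_lt_set d (T : measurableType d) (R : realType) (f g : T -> R) :
  measurable_fun setT f -> measurable_fun setT g ->
  measurable [set x | f x < g x].
Proof.
move=> mf mg; rewrite (_ : mkset _ = ~` [set x | g x <= f x]).
  by apply: measurableC; exact: measurable_le_set.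
by apply/seteqP; split => x /=; rewrite real_ltNge ?num_real// => /negP.
Qed.

Lemma exponential_tail d (Omega : measurableType d) (R : realType)
    (P : probability Omega R) (X : {RV P >-> R}) :
  (forall B : set R, measurable B ->
     distribution P X B = exponential_prob 1 B) ->
  forall x : R, 0 <= x -> P [set w | x < X w] = (expR (- x))%:E.
Proof.
move=> Xexp x x0.
have -> : [set w | x < X w] = ~` (X @^-1` `]-oo, x]%classic).
  by apply/seteqP; split => w /=; rewrite in_itv/= real_ltNge ?num_real//; move/negP.
have mX B : measurable B -> measurable (X @^-1` B).
  by move=> mB; rewrite -[_ @^-1` _]setTI; exact: measurable_funPT.
rewrite probability_setC; last exact: mX.
(* The density vanishes on the negatives, so only [[0, x]] carries mass; for [x = 0] this is a null
   singleton, treated apart from the closed formula. *)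
have -> : X @^-1` `]-oo, x] = X @^-1` `]-oo, 0[ `|` X @^-1` `[0, x].
  apply/seteqP; split => w /=; rewrite !in_itv/=.
    by move=> Xx; case: (ltP (X w) 0) => h; [left|right].
  by case=> [/ltW/le_trans|/andP[]//]; apply.
rewrite measureU; [|exact: mX|exact: mX|]; last first.
  apply/seteqP; split => w //=; rewrite !in_itv/= => -[h /andP[h' _]].
  by move: (lt_le_trans h h'); rewrite ltxx.
transitivity (1 - (distribution P X `]-oo, 0%R[%classic +
                   distribution P X `[0%R, x]%classic))%E; first by [].
rewrite !Xexp// [X in (_ - (X + _))%E]integral0_eq ?add0e; last first.
  by move=> y /=; rewrite in_itv/= => y0; rewrite lt0_exponential_pdf.
move: x0; rewrite le_eqVlt => /predU1P[<-|x0].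
  rewrite set_itv1 /exponential_prob integral_set1 ?oppr0 ?expR0 ?sube0//.
by rewrite exponential_prob_itv0c// mulN1r -EFinD; congr EFin; ring.
Qed.

(** For negative [x] the bound exceeds [1]. Such thresholds arise as [k j - a] in the Borel-Cantelli
    argument. *)
Lemma exponential_tail_le d (Omega : measurableType d) (R : realType)
    (P : probability Omega R) (X : {RV P >-> R}) :
  (forall x : R, 0 <= x -> P [set w | x < X w] = (expR (- x))%:E) ->
  forall x : R, (P [set w | (x < X w)%R] <= (expR (- x))%:E)%E.
Proof.
move=> tail x; have [x0|x0] := leP 0 x; first by rewrite tail.
apply: le_trans (probability_le1 _ _) _.
  exact: measurable_lt_set.
by rewrite lee_fin -expR0 ler_expR oppr_ge0 ltW.
Qed.

(** By the layer-cake formula this is the integral over [r >= 0] of the tail [expR (- (c + r))],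
    which is [expR (- c)] times the exponential density. Taking [c = k j] gives a term of the Kraft
    sum, and [c = 0] gives the mean [1]. *)
Lemma expectation_exponential_excess d (Omega : measurableType d)
    (R : realType) (P : probability Omega R) (X : {RV P >-> R}) (c : R) :
  (forall x : R, 0 <= x -> P [set w | x < X w] = (expR (- x))%:E) ->
  0 <= c ->
  (\int[P]_w (Num.max (X w - c) 0)%:E = (expR (- c))%:E)%E.
Proof.
move=> tail c0.
have mY : measurable_fun setT (fun w => Num.max (X w - c) 0).
  by apply: measurable_maxr => //; exact: measurable_funB.
pose Y : {mfun Omega >-> R} := HB.pack (fun w => Num.max (X w - c) 0)
  (isMeasurableFun.Build _ _ _ _ _ mY).
have -> : (\int[P]_w (Num.max (X w - c) 0)%:E = 'E_P[Y])%E.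
  by rewrite expectation_def.
rewrite (ge0_expectation_ccdf (X := Y)); last by move=> w; rewrite /= le_max lexx orbT.
transitivity (\int[lebesgue_measure]_(r in `[0%R, +oo[)
   ((expR (- c))%:E * (exponential_pdf 1 r)%:E))%E.
  apply: eq_integral => r; rewrite inE/= in_itv/= andbT => r0.
  rewrite exponential_pdfE// mul1r mulN1r -EFinM -expRD.
  transitivity (P [set w | (c + r < X w)%R]).
    congr (P _); apply/seteqP; split => w /=;
      rewrite in_itv/= andbT lt_max [_ < 0]ltNge r0/= orbF; lra.
  by rewrite tail ?addr_ge0// opprD.
rewrite ge0_integralZl_EFin//; first last.
- apply: measurable_funTS; apply/measurable_EFinP.
  exact: measurable_exponential_pdf.
- by move=> r _; rewrite lee_fin exponential_pdf_ge0.
transitivity ((expR (- c))%:E * \int[lebesgue_measure]_r (exponential_pdf 1 r)%:E)%E.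
  congr (_ * _)%E; rewrite [LHS]integral_mkcond/=.
  apply: eq_integral => r _; rewrite patchE; case: ifPn => // r0.
  rewrite lt0_exponential_pdf// ltNge.
  by apply: contra r0 => r0; rewrite inE/= in_itv/= r0.
by rewrite integral_exponential_pdf// mule1.
Qed.

(** * Independence and the memoryless property *)

(** Mutual independence speaks of finite families; continuity from above along the truncations [D N]
    extends it to all indices of [A] other than [i]. *)
Lemma mutually_independent_setI_bigcap d (Omega : measurableType d)
    (R : realType) (P : probability Omega R) (A : set nat)
    (q : nat -> {RV P >-> R}) (i : nat) (B0 : set R) (B : nat -> set R) :
  mutually_independent A q -> A i -> measurable B0 ->
  (forall j, measurable (B j)) ->
  P (q i @^-1` B0 `&` \bigcap_(j in A `\ i) (q j @^-1` B j)) =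
  (P (q i @^-1` B0) * P (\bigcap_(j in A `\ i) (q j @^-1` B j)))%E.
Proof.
move=> indep Ai mB0 mB.
have mq j C : measurable C -> measurable (q j @^-1` C).
  by move=> mC; rewrite -[_ @^-1` _]setTI; exact: measurable_funPT.
pose D N := (A `\ i) `&` `I_N.
pose F N := \bigcap_(j in D N) (q j @^-1` B j).
have mF N : measurable (F N) by apply: bigcap_measurableType => // j _; exact: mq.
have bigcapF : \bigcap_N F N = \bigcap_(j in A `\ i) (q j @^-1` B j).
  apply/seteqP; split => [w h j Aj|w h N _ j [Aj _]]; last exact: h.
  by apply: (h j.+1) => //; split => //=.
have niF : nonincreasing_seq F.
  move=> M N MN; apply/subsetPset => w h j [Aj jM]; apply: h; split => //=.
  exact: leq_trans MN.
have mcap : measurable (\bigcap_N F N) by exact: bigcap_measurableType.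
have F_indep N : P (q i @^-1` B0 `&` F N) = (P (q i @^-1` B0) * P (F N))%E.
  pose J := fset_set (D N).
  have finD : finite_set (D N) by apply: finite_setIr; exact: finite_II.
  have JD : [set` J] = D N by rewrite fset_setK.
  have iJ : i \notin J.
    by apply/negP; rewrite in_fset_set// inE => -[[_ /(_ erefl)]].
  (* [C] merges [B0] and [B] into one family, so that independence applies both over [J] and over
     [J] with [i] added. *)
  pose C j := if j == i then B0 else B j.
  have mC j : measurable (C j) by rewrite /C; case: ifP.
  have CB j : j \in J -> C j = B j.
    by rewrite /C; case: eqP => // ->; rewrite (negbTE iJ).
  have FC : F N = \bigcap_(j in [set` J]) (q j @^-1` C j).
    by rewrite /F -JD; apply: eq_bigcapr => j /= jJ; rewrite CB.
  have AJ : [set` J] `<=` A by rewrite JD => j [[]].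
  have AiJ : [set` (i |` J)%fset] `<=` A.
    by rewrite set_fsetU1 => j [->//|]; exact: AJ.
  have CB0 : C i = B0 by rewrite /C eqxx.
  transitivity (P (\bigcap_(j in [set` (i |` J)%fset]) (q j @^-1` C j))).
    by rewrite set_fsetU1 bigcap_setU1 CB0 FC.
  by rewrite indep// big_fsetU1//= -indep// -FC CB0.
have cvgF : P (F N) @[N --> \oo] --> P (\bigcap_N F N).
  apply: nonincreasing_cvg_mu => //.
  by rewrite (le_lt_trans (probability_le1 P (mF _)))// ltry.
have mX := mq i _ mB0.
have cvgXF : P (q i @^-1` B0 `&` F N) @[N --> \oo] -->
    P (q i @^-1` B0 `&` \bigcap_N F N).
  rewrite -bigcapIr; last by exists 0%N.
  apply: nonincreasing_cvg_mu => //.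
  - rewrite (le_lt_trans (probability_le1 P _))// ?ltry//.
    exact: measurableI.
  - by move=> N; exact: measurableI.
  - by apply: bigcap_measurableType => // N _; exact: measurableI.
  - by move=> M N MN; apply/subsetPset; apply: setIS; apply/subsetPset/niF.
rewrite -bigcapF; apply: (cvg_unique _ cvgXF) => //.
rewrite (_ : (fun N => _) = (fun N => P (q i @^-1` B0) * P (F N))%E); last first.
  by apply/funext => N; rewrite F_indep.
by apply: cvgeZl => //; exact: fin_num_measure.
Qed.

(* The memoryless property: shifting the threshold by [t] costs at most a
   factor [expR t]. The threshold is the level at which [w] enters the family
   [E], and it is sliced into a mesh of width [h], which is sent to [0]. *)
Lemma exponential_shift d (Omega : measurableType d) (R : realType)
    (P : probability Omega R) (X : {RV P >-> R}) (E : R -> set Omega) (t : R) :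
  (forall x : R, 0 <= x -> P [set w | x < X w] = (expR (- x))%:E) ->
  (forall b, measurable (E b)) ->
  (forall a b, a <= b -> E a `<=` E b) ->
  (forall x b, P ([set w | x < X w] `&` E b) =
               (P [set w | (x < X w)%R] * P (E b))%E) ->
  (forall u, measurable [set w | E (X w - u) w]) ->
  0 <= t ->
  (P [set w | E (X w) w] <= (expR t)%:E * P [set w | E (X w - t)%R w])%E.
Proof.
move=> tail mE Emono indep mL t0.
pose L u := [set w | E (X w - u) w].
have -> : [set w | E (X w) w] = L 0.
  by apply/seteqP; split=> w; rewrite /L/= subr0.
have mX x : measurable [set w | x < X w] by exact: measurable_lt_set.
(* The slack [h] vanishes in the limit, by [expR (- h) >= 1 - h] and [P (L 0) <= 1]. *)
suff main (h : R) : 0 < h -> (P (L 0%R) <= (expR (t + h))%:E * P (L t))%E.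
  have fP u : P (L u) \is a fin_num by apply: fin_num_measure; exact: mL.
  rewrite -[P (L 0%R)]fineK// -[P (L t)]fineK// -EFinM lee_fin.
  apply/ler_addgt0Pr => h h0.
  have := main h h0.
  rewrite -[P (L 0%R)]fineK// -[P (L t)]fineK// -EFinM lee_fin => le_h.
  have x1 : fine (P (L 0%R)) <= 1.
    by rewrite -lee_fin fineK// probability_le1//; exact: mL.
  have x0 : 0 <= fine (P (L 0%R)) by rewrite fine_ge0.
  have e_h := expR_ge1Dx (- h).
  have -> : expR t * fine (P (L t)) = expR (- h) * (expR (t + h) * fine (P (L t))).
    by rewrite mulrA -expRD addrCA addNr addr0.
  apply: (@le_trans _ _ (expR (- h) * fine (P (L 0%R)) + h)).
    have := ler_wpM2r x0 e_h; rewrite mulrDl mul1r mulNr.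
    by have := ler_wpM2l (ltW h0) x1; lra.
  by rewrite lerD2r ler_wpM2l// expR_ge0.
move=> h0.
(* [S m.+1] collects the outcomes that enter [E] between the levels [m * h] and [m.+1 * h]; [S 0]
   takes all those present at level [0]. *)
pose S m := if m is m'.+1 then E (m'.+1%:R * h) `\` E (m'%:R * h) else E 0.
have mS m : measurable (S m) by case: m => [|m] /=; [|apply: measurableD].
have SE m : S m `<=` E (m%:R * h).
  by case: m => [|m] w /=; [rewrite mul0r|case].
have tS : trivIset setT S.
  apply: ltn_trivIset => -[//|p] m; rewrite ltnS => mp.
  apply/seteqP; split => // w [/SE Ew [_]]; apply.
  by apply: Emono Ew; rewrite ler_wpM2r ?ler_nat// ltW.
have Poo B : measurable B -> (P B < +oo)%E.
  by move=> mB; rewrite (le_lt_trans (probability_le1 P mB))// ltry.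
have indepS x m : P ([set w | x < X w] `&` S m) =
                  (P [set w | (x < X w)%R] * P (S m))%E.
  case: m => [|m] //=.
  have sub : E (m%:R * h) `<=` E (m.+1%:R * h).
    by apply: Emono; rewrite ler_wpM2r ?ler_nat// ltW.
  have PD B C : measurable B -> measurable C -> C `<=` B ->
      P (B `\` C) = (P B - P C)%E.
    by move=> mB mC /setIidr BC; rewrite measureD//= ?BC//; exact: Poo.
  rewrite setIDA (_ : _ `\` _ =
    ([set w | x < X w] `&` E (m.+1%:R * h)) `\`
    ([set w | x < X w] `&` E (m%:R * h))); last first.
    by apply/seteqP; split => w /=; tauto.
  rewrite !PD//; [|exact: measurableI|exact: measurableI|exact: setIS].
  rewrite !indep muleBr// ?fin_num_measure//.
  by rewrite fin_num_adde_defr// fin_num_measure.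
(* On [S m], membership in [L 0] forces [X w > lo] if [m > 0], and [X w > hi + t] forces membership
   in [L t]. Both tails are independent of the slice, and [hi <= lo + h] compares them. For [m = 0],
   [lo] is [0] and the first bound is trivial. *)
have slice m : (P (L 0%R `&` S m) <= (expR (t + h))%:E * P (L t `&` S m))%E.
  have mLS u : measurable (L u `&` S m) by apply: measurableI; [exact: mL|].
  pose lo : R := m.-1%:R * h.
  have lo0 : 0 <= lo by rewrite mulr_ge0// ltW.
  pose hi : R := m%:R * h.
  have hi0 : 0 <= hi by rewrite mulr_ge0// ltW.
  have lohi : hi <= lo + h.
    rewrite /lo /hi; case: (m) => [|m'] /=; first by rewrite mul0r add0r ltW.
    by rewrite -natr1 mulrDl mul1r.
  apply: (@le_trans _ _ ((expR (- lo))%:E * P (S m))%E).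
    case: m @lo @hi lo0 hi0 lohi mLS => [|m] lo hi lo0 hi0 lohi mLS.
      rewrite /lo mul0r oppr0 expR0 mul1e le_measure ?inE// => w [].
    rewrite -tail// -indepS le_measure// ?inE//; first exact: measurableI.
    move=> w [Lw Sw]; split => //=; rewrite ltNge; apply/negP => Xlo.
    case: Sw => _; apply; apply: Emono Lw.
    by rewrite subr0.
  apply: (@le_trans _ _ ((expR (t + h))%:E * ((expR (- (hi + t)))%:E * P (S m)))%E).
    rewrite muleA -EFinM -expRD lee_wpmul2r// lee_fin ler_expR.
    lra.
  rewrite lee_wpmul2l ?lee_fin ?expR_ge0// -tail ?addr_ge0// -indepS.
  rewrite le_measure// ?inE//; first exact: measurableI.
  move=> w [/= Xw Sw]; split => //; apply: Emono (SE _ _ Sw).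
  by rewrite lerBrDr ltW.
have mLS u m : measurable (L u `&` S m) by apply: measurableI; [exact: mL|].
have PLS u : P (\bigcup_m (L u `&` S m)) = (\sum_(m <oo) P (L u `&` S m))%E.
  apply: measure_semi_bigcup => //; last exact: bigcup_measurable.
  by apply: trivIset_setIl.
(* An outcome of [L 0] has entered [E] by level [X w], hence by some multiple of [h]; the least such
   multiple gives its slice. For [L t], it suffices that it contains its slices. *)
have -> : L 0 = \bigcup_m (L 0%R `&` S m).
  apply/seteqP; split => [w Lw|w [m _ []//]].
  have ex : exists m, `[< E (m%:R * h) w >].
    exists (Num.bound `|X w / h|); apply/asboolP.
    apply: Emono Lw; rewrite subr0 -ler_pdivrMr//.
    by apply: le_trans (ler_norm _) (ltW _); exact: archi_boundP.
  exists (ex_minn ex) => //; split => //.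
  case: ex_minnP => -[|m] /asboolP Em min; rewrite /S/=.
    by rewrite mul0r in Em.
  by split => // /asboolP/min; rewrite ltnn.
rewrite PLS.
apply: (@le_trans _ _ (\sum_(m <oo) ((expR (t + h))%:E * P (L t `&` S m)))%E).
  by apply: lee_nneseries => // m _; exact: slice.
rewrite nneseriesZl// -PLS lee_wpmul2l ?lee_fin ?expR_ge0//.
rewrite le_measure// ?inE//; [exact: bigcup_measurable|exact: mL|].
by move=> w [m _ []].
Qed.

(** * Series of weighted indicators *)

(** The loss of a randomly chosen expert is written as such a series, which can be integrated term
    by term. *)
Lemma nneseries_indic (R : realType) (T : Type) (F : nat -> set T)
    (a : nat -> R) (w : T) (i : nat) :
  (forall j, 0 <= a j) -> (forall j, F j w -> j = i) -> F i w ->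
  (\sum_(j <oo) (a j * \1_(F j) w)%:E = (a i)%:E)%E.
Proof.
move=> a0 uniq_i Fi.
rewrite (nneseriesD1 (n := i))//; last first.
  by move=> j _; rewrite lee_fin mulr_ge0.
rewrite eseries0 ?adde0; last first.
  move=> j _ /= ji; rewrite indicE memNset ?mulr0//.
  by move=> /uniq_i jE; rewrite jE eqxx in ji.
by rewrite indicE mem_set// mulr1.
Qed.

Lemma nneseries_indic0 (R : realType) (T : Type) (F : nat -> set T)
    (a : nat -> R) (w : T) :
  (forall j, ~ F j w) -> (\sum_(j <oo) (a j * \1_(F j) w)%:E = 0)%E.
Proof.
by move=> F0; rewrite eseries0// => j _ _; rewrite indicE memNset ?mulr0.
Qed.

Lemma measurable_nneseries_indic d (T : measurableType d) (R : realType)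
    (F : nat -> set T) (a : nat -> R) :
  (forall j, 0 <= a j) -> (forall j, measurable (F j)) ->
  measurable_fun setT (fun w => \sum_(j <oo) (a j * \1_(F j) w)%:E)%E.
Proof.
move=> a0 mF; apply: ge0_emeasurable_sum => j.
  by move=> w _ _; rewrite lee_fin mulr_ge0.
by move=> _; apply/measurable_EFinP; apply: measurable_funM.
Qed.

Lemma integral_nneseries_indic d (T : measurableType d) (R : realType)
    (mu : {measure set T -> \bar R}) (F : nat -> set T) (a : nat -> R) :
  (forall j, 0 <= a j) -> (forall j, measurable (F j)) ->
  (\int[mu]_w (\sum_(j <oo) (a j * \1_(F j) w)%:E) =
   \sum_(j <oo) ((a j)%:E * mu (F j)))%E.
Proof.
move=> a0 mF; rewrite integral_nneseries//; first last.
- by move=> j w _; rewrite lee_fin mulr_ge0.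
- by move=> j; apply/measurable_EFinP; apply: measurable_funM.
apply: eq_eseriesr => j _; under eq_integral do rewrite EFinM.
by rewrite ge0_integralZl_EFin ?integral_indic ?setIT//; exact/measurable_EFinP.
Qed.

Lemma nneseries_patch (R : realType) (A : set nat) (a : nat -> R) :
  (forall j, A j -> 0 <= a j) ->
  (\sum_(j <oo) (if j \in A then a j else 0)%:E = \esum_(j in A) (a j)%:E)%E.
Proof.
move=> a0; rewrite (_ : A = [set j | j \in A]); last first.
  by apply/seteqP; split => j /=; rewrite inE.
rewrite -nneseries_esum; last by move=> j /set_mem/a0; rewrite lee_fin.
rewrite [RHS]eseries_mkcond; apply: eq_eseriesr => j _.
by rewrite (_ : [set k | k \in A] = A)//; [case: ifP|apply/seteqP; split => k /=; rewrite inE].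
Qed.

(** * Borel-Cantelli and the existence of minimizers *)

(** The exceptional set is the limit superior of the events, null by the first Borel-Cantelli
    lemma. *)
Lemma ae_eventually_not d (T : measurableType d) (R : realType)
    (mu : {measure set T -> \bar R}) (F : nat -> set T) :
  (forall j, measurable (F j)) -> (\sum_(j <oo) mu (F j) < +oo)%E ->
  {ae mu, forall w, exists N, forall j, (N <= j)%N -> ~ F j w}.
Proof.
move=> mF Foo; exists (lim_sup_set F); split.
- apply: bigcapT_measurable => N; apply: bigcup_measurable => j _; exact: mF.
- exact: lim_sup_set_cvg0.
- move=> w /= nex N _; apply: contrapT => nF; apply: nex; exists N => j Nj Fj.
  by apply: nF; exists j.
Qed.

(** The better of [i] and some [m] that is unbeaten below [N] is a minimizer. The search for [m]
    starts from [i], so [A] may have no element below [N]. *)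
Lemma argmin_in_neq0 (R : realType) (A : set nat) (f : nat -> R) (i N : nat) :
  A i -> (forall j, (N <= j)%N -> A j -> f i <= f j) ->
  argmin_in A f !=set0.
Proof.
move=> Ai Nf.
have : exists m, A m /\ forall j, A j -> (j < N)%N -> f m <= f j.
  elim: N {Nf} => [|N [m [Am IH]]]; first by exists i.
  have [/asboolP/andP[/asboolP AN fN]|h] := boolP `[< `[< A N >] && (f N <= f m) >].
    exists N; split => // j Aj; rewrite ltnS leq_eqVlt => /predU1P[->//|jN].
    exact: le_trans fN (IH _ Aj jN).
  exists m; split => // j Aj; rewrite ltnS leq_eqVlt => /predU1P[jN|]; last exact: IH.
  rewrite leNgt; apply/negP => fj; move/asboolP: h; apply.
  by rewrite -jN; apply/andP; split; [apply/asboolP|exact: ltW].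
move=> [m [Am mmin]].
have [mi|im] := leP (f m) (f i).
  exists m; split => // j Aj; have [jN|Nj] := ltnP j N; first exact: mmin.
  exact: le_trans mi (Nf _ Nj Aj).
exists i; split => // j Aj; have [jN|Nj] := ltnP j N; last exact: Nf.
exact: le_trans (ltW im) (mmin _ Aj jN).
Qed.

(** * Gap leaders: probability and regret *)

(* With perturbed scores [v j - x j], the set of those experts whose score is
   below all the others by at least [theta]: the minimizers if [theta = 0], at
   most one expert if [theta > 0]. *)
Definition gap_leader (R : realType) (A : set nat) (v : nat -> R) (theta : R)
    (x : nat -> R) : set nat :=
  [set i | A i /\
    forall j, A j -> j <> i -> v i - x i + theta <= v j - x j].

Lemma gap_leader_inj (R : realType) (A : set nat) (v : nat -> R) (theta : R)
    (x : nat -> R) (i j : nat) : 0 < theta ->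
  gap_leader A v theta x i -> gap_leader A v theta x j -> i = j.
Proof.
move=> theta0 [Ai imin] [Aj jmin]; apply: contrapT => ij.
have /imin-/(_ Aj) h : j <> i by move/esym.
by have := jmin _ Ai ij; lra.
Qed.

(** Isolates [q i] as a threshold for a family of events that is increasing in the threshold and
    depends only on the other perturbations, the form that [exponential_shift] takes. *)
Lemma gap_leaderE d (Omega : measurableType d) (R : realType)
    (P : probability Omega R) (A : set nat) (q : nat -> {RV P >-> R})
    (v : nat -> R) (theta : R) (i : nat) : A i ->
  [set w | gap_leader A v theta (q ^~ w) i] =
  [set w | (\bigcap_(j in A `\ i)
     (q j @^-1` `]-oo, q i w - theta - (v i - v j)]%classic)) w].
Proof.
move=> Ai; apply/seteqP; split => w /=.
  by move=> [_ h] j [Aj ji]; rewrite /= in_itv/=; have := h j Aj ji; lra.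
move=> h; split => // j Aj ji.
by have := h j (conj Aj ji); rewrite /= in_itv/=; lra.
Qed.

Lemma measurable_gap_leader d (Omega : measurableType d) (R : realType)
    (P : probability Omega R) (A : set nat) (q : nat -> {RV P >-> R})
    (v : nat -> R) (theta : R) (i : nat) :
  measurable [set w | gap_leader A v theta (q ^~ w) i].
Proof.
have [Ai|nAi] := pselect (A i); last first.
  by rewrite (_ : mkset _ = set0)//; apply/seteqP; split => w // -[].
rewrite (_ : mkset _ = \bigcap_(j in A `\ i)
    [set w | v i - q i w + theta <= v j - q j w]); last first.
  apply/seteqP; split => w /=.
    by move=> [_ h] j [Aj ji]; exact: h.
  by move=> h; split => // j Aj ji; exact: h.
apply: bigcap_measurableType => j _; apply: measurable_le_set.
  by apply: measurable_funD => //; exact: measurable_funB.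
exact: measurable_funB.
Qed.

Lemma probability_gap_leader d (Omega : measurableType d) (R : realType)
    (P : probability Omega R) (A : set nat) (q : nat -> {RV P >-> R})
    (v : nat -> R) (theta : R) (i : nat) :
  mutually_independent A q -> A i ->
  (forall x : R, 0 <= x -> P [set w | x < q i w] = (expR (- x))%:E) ->
  0 <= theta ->
  (P [set w | gap_leader A v 0 (q ^~ w) i] <=
   (expR theta)%:E * P [set w | gap_leader A v theta%R (q ^~ w) i])%E.
Proof.
move=> indep Ai tail theta0.
pose E b := \bigcap_(j in A `\ i) (q j @^-1` `]-oo, b - (v i - v j)]%classic).
have LE u : [set w | gap_leader A v u (q ^~ w) i] = [set w | E (q i w - u) w].
  by rewrite gap_leaderE.
rewrite !LE; rewrite (_ : [set w | E (q i w - 0) w] = [set w | E (q i w) w]); last first.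
  by apply/seteqP; split => w /=; rewrite subr0.
apply: exponential_shift => //.
- move=> b; apply: bigcap_measurableType => j _.
  by rewrite -[_ @^-1` _]setTI; exact: measurable_funPT.
- move=> a b ab w h j /h; rewrite /= !in_itv/=; lra.
- move=> x b.
  have -> : [set w | x < q i w] = q i @^-1` `]x, +oo[%classic.
    by apply/seteqP; split => w /=; rewrite in_itv/= andbT.
  exact: mutually_independent_setI_bigcap.
- by move=> u; rewrite -LE; exact: measurable_gap_leader.
Qed.

(** Induction on [t], for all [i] at once. Adding [M] makes every [k j - x j + M] nonnegative, so
    that passing to the larger [(eta t.+1)^-1] only weakens the bound. *)
Lemma gap_leader_regret (R : realType) (A : set nat) (k eta x : nat -> R)
    (s : nat -> nat -> R) (T : nat) (M : R) (g : nat -> R) :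
  (forall t i, (1 <= t <= T)%N -> A i -> 0 <= s t i <= 1) ->
  (forall t, (1 <= t <= T)%N -> 0 < eta t) -> 0 <= eta 0 ->
  (forall t, (t < T)%N -> (eta t)^-1 <= (eta t.+1)^-1) ->
  (forall j, A j -> x j - k j <= M) ->
  (forall t, (1 <= t <= T)%N -> g t = 0 \/ exists2 i,
     gap_leader A (fun j => eta t * loss_before s t j + k j) (eta t) x i &
     g t = s t i) ->
  forall t i, (t <= T)%N -> A i ->
    \sum_(1 <= u < t.+1) g u <= loss_upto s t i + (k i - x i + M) / eta t.
Proof.
move=> s01 eta_gt0 eta0 eta_mono xM gP; elim=> [|t IH] i tT Ai.
  (* Only [(eta 0)^-1 >= 0] matters here; the rates used later have [eta 0 = 0], with inverse
     [0]. *)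
  rewrite /loss_upto !big_nil add0r mulr_ge0 ?invr_ge0//.
  by have := xM i Ai; lra.
have tT' : (1 <= t.+1 <= T)%N by [].
have mono j : A j ->
    (k j - x j + M) / eta t <= (k j - x j + M) / eta t.+1.
  move=> Aj; apply: ler_wpM2l; last exact: eta_mono.
  by have := xM j Aj; lra.
have lossS j : loss_upto s t.+1 j = loss_upto s t j + s t.+1 j.
  by rewrite /loss_upto big_nat_recr.
rewrite big_nat_recr//= lossS.
case: (gP _ tT') => [->|[m [Am mlead] ->]].
  have := IH i (ltnW tT) Ai; have := mono i Ai.
  by have /andP[] := s01 _ i tT' Ai; lra.
(* The induction hypothesis is used at the leader [m], whose lead then transfers the bound to
   [i]. *)
have := IH m (ltnW tT) Am; have := mono m Am.
have [-> |im] := pselect (i = m); first lra.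
have := mlead i Ai im; have upto j : loss_before s t.+1 j = loss_upto s t j by [].
rewrite !upto => lead.
have /andP[_ sm1] := s01 _ m tT' Am; have /andP[si0 _] := s01 _ i tT' Ai.
have e0 := eta_gt0 _ tT'; set e := eta t.+1 in e0 lead *.
have div y L : (e * L + y + M) / e = L + (y + M) / e.
  by field; rewrite gt_eqF.
(* A gap of [e] between scaled scores is a gap of [1] after division by [e], which pays for
   [s t.+1 m <= 1]. *)
have : (e * loss_upto s t m + (k m - x m) + M) / e + 1 <=
    (e * loss_upto s t i + (k i - x i) + M) / e.
  rewrite -[1](@divff _ e) ?gt_eqF// -mulrDl ler_pM2r ?invr_gt0//; lra.
rewrite !div; lra.
Qed.

(** * Almost sure attainment of the minimum *)

Lemma ae_argmin_in_neq0 d (Omega : measurableType d) (R : realType)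
    (P : probability Omega R) (A : set nat) (q : nat -> {RV P >-> R})
    (k f : nat -> R) (e : R) (i : nat) :
  A i -> (\esum_(j in A) (expR (- k j))%:E <= 1)%E ->
  (forall j, A j -> forall x : R, 0 <= x ->
     P [set w | x < q j w] = (expR (- x))%:E) ->
  (forall j, A j -> 0 <= f j) -> 0 < e ->
  {ae P, forall w, argmin_in A (fun j => f j + (k j - q j w) / e) !=set0}.
Proof.
move=> Ai kraft tail f0 e0.
(* [F a j] has probability at most [expR a * expR (- k j)], summable by Kraft. The level needed
   depends on [w], so Borel-Cantelli is applied at all natural [a] simultaneously. *)
pose F (a : nat) j := [set w | A j /\ k j - a%:R < q j w].
have mF a j : measurable (F a j).
  have [Aj|nAj] := pselect (A j); last first.
    by rewrite (_ : F a j = set0)//; apply/seteqP; split => w // -[].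
  rewrite (_ : F a j = [set w | k j - a%:R < q j w]).
    exact: measurable_lt_set.
  by apply/seteqP; split => w // -[].
have PF a : (\sum_(j <oo) P (F a j) < +oo)%E.
  apply: (@le_lt_trans _ _ ((expR a%:R)%:E *
      \sum_(j <oo) (if j \in A then expR (- k j) else 0)%:E)%E).
    rewrite -nneseriesZl//; last by move=> j _; case: ifP.
    apply: lee_nneseries => // j _; case: ifPn => [/set_mem Aj|/negP nAj].
      rewrite -EFinM -expRD -[_ + _]opprK opprD opprK.
      apply: le_trans (exponential_tail_le (tail j Aj) _).
      rewrite le_measure ?inE//; first exact: measurable_lt_set.
      by move=> w [_]; rewrite /= addrC.
    rewrite (_ : F a j = set0) ?measure0 ?mule0//.
    by apply/seteqP; split => w // -[Aj]; exfalso; apply: nAj; rewrite inE.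
  rewrite nneseries_patch; last by move=> j _; exact: expR_ge0.
  apply: (@le_lt_trans _ _ ((expR a%:R)%:E * 1)%E); last by rewrite mule1 ltry.
  by rewrite lee_wpmul2l// lee_fin expR_ge0.
have : {ae P, forall w a, exists N, forall j, (N <= j)%N -> ~ F a j w}.
  by apply/ae_foralln => a; exact: (ae_eventually_not (mF a) (PF a)).
move=> ae_tight; apply: filterS ae_tight => w tight.
pose v := f i + (k i - q i w) / e.
(* The level exceeds [v * e], where [v] is the score of [i]: beyond [N], every score is at least
   [v]. *)
have [N FN] := tight (Num.bound `|v * e|).
apply: (@argmin_in_neq0 _ _ _ i N) => // j Nj Aj.
have : ~~ (k j - (Num.bound `|v * e|)%:R < q j w).
  by apply/negP => h; exact: FN Nj (conj Aj h).
rewrite -leNgt => qj.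
apply: (@le_trans _ _ ((k j - q j w) / e)); last by rewrite lerDr f0.
rewrite ler_pdivlMr//; have := archi_boundP (normr_ge0 (v * e)).
have := ler_norm (v * e); rewrite -/v; lra.
Qed.

(** * Regret of FPL for general learning rates *)

Section FPL_regret_bound.
Context (R : realType) (d : measure_display) (Omega : measurableType d)
  (P : probability Omega R) (n : option nat) (k eta : nat -> R) (T : nat)
  (s : nat -> nat -> R) (q : nat -> {RV P >-> R}) (I : nat -> {RV P >-> nat}).
Hypothesis kraft : (\esum_(i in experts n) (expR (- k i))%:E <= 1)%E.
Hypothesis s_01 :
  forall t i, (1 <= t <= T)%N -> experts n i -> 0 <= s t i <= 1.
Hypothesis q_indep : mutually_independent (experts n) q.
Hypothesis q_tail : forall i, experts n i -> forall x : R, 0 <= x ->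
  P [set w | x < q i w] = (expR (- x))%:E.
Hypothesis I_sel : FPL_selection n k eta s q T I.

(** Set to [0] off the experts, where [s] is unconstrained, so that series can run over all of
    [nat]. *)
Definition patched_loss t i : R := if i \in experts n then s t i else 0.

(** Multiplying the FPL score by [eta t] gives the perturbation coefficient [-1], so a rate-1
    exponential variable is compared directly. *)
Definition scaled_score t i : R := eta t * loss_before s t i + k i.

(* When some expert leads by at least [eta t], this is its loss at time [t];
   otherwise it is [0]. Losses being at most 1, such a leader is still a leader
   once the losses of time [t] are known. *)
Definition gap_loss t (w : Omega) : \bar R :=
  (\sum_(i <oo) (patched_loss t i *
     \1_[set w | gap_leader (experts n) (scaled_score t) (eta t) (q ^~ w) i] w)%:E)%E.

Lemma patched_loss_ge0 t i : (1 <= t <= T)%N -> 0 <= patched_loss t i.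
Proof.
move=> tT; rewrite /patched_loss; case: ifPn => // /set_mem ni.
by case/andP: (s_01 tT ni).
Qed.

Lemma loss_before_ge0 t i : (t <= T)%N -> experts n i -> 0 <= loss_before s t i.
Proof.
move=> tT ni; rewrite /loss_before big_nat sumr_ge0// => u /andP[u1 ut].
have uT : (1 <= u <= T)%N by rewrite u1 (leq_trans (ltnW ut)).
by case/andP: (s_01 uT ni).
Qed.

Lemma measurable_gap_loss t : (1 <= t <= T)%N ->
  measurable_fun setT (gap_loss t).
Proof.
move=> tT; apply: measurable_nneseries_indic => j; first exact: patched_loss_ge0.
exact: measurable_gap_leader.
Qed.

Lemma gap_loss_ge0 t w : (1 <= t <= T)%N -> (0 <= gap_loss t w)%E.
Proof.
move=> tT; apply: nneseries_ge0 => j _ _.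
by rewrite lee_fin mulr_ge0// patched_loss_ge0.
Qed.

Lemma FPL_lossE t : (1 <= t <= T)%N ->
  FPL_loss s I t =
  (\int[P]_w \sum_(i <oo) (patched_loss t i * \1_(I t @^-1` [set i]) w)%:E)%E.
Proof.
move=> tT; rewrite /FPL_loss unlock; apply: eq_integral => w _.
rewrite (nneseries_indic (i := I t w))//.
- by rewrite /patched_loss mem_set//; case: (I_sel tT w).
- by move=> j; exact: patched_loss_ge0.
Qed.

Lemma measurable_selected t i : measurable (I t @^-1` [set i]).
Proof. by rewrite -[_ @^-1` _]setTI; exact: measurable_funPT. Qed.

Lemma FPL_loss_le_expR t : (1 <= t <= T)%N -> 0 < eta t ->
  (FPL_loss s I t <= (expR (eta t))%:E * \int[P]_w gap_loss t w)%E.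
Proof.
move=> tT eta0.
have pl0 j : 0 <= patched_loss t j by exact: patched_loss_ge0.
rewrite FPL_lossE// integral_nneseries_indic//; last by move=> j; exact: measurable_selected.
rewrite integral_nneseries_indic//; last by move=> j; exact: measurable_gap_leader.
rewrite -nneseriesZl//; last by move=> j _; rewrite mule_ge0 ?lee_fin.
apply: lee_nneseries => [j _ _|j _]; first by rewrite mule_ge0 ?lee_fin.
rewrite muleCA; have [nj|nj] := pselect (experts n j); last first.
  by rewrite /patched_loss memNset// !mul0e.
rewrite lee_wpmul2l ?lee_fin//.
apply: le_trans (probability_gap_leader (scaled_score t) q_indep nj (q_tail nj) (ltW eta0)).
have tT' : (t <= T)%N by case/andP: tT.
have [N [mN N0 subN]] := ae_argmin_in_neq0 nj kraft q_tail
  (fun j => loss_before_ge0 tT') eta0.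
have mL := measurable_gap_leader (experts n) q (scaled_score t) 0 j.
(* Outside the null set [N] a minimizer exists, so a selected [j] leads with gap [0]. *)
apply: (@le_trans _ _ (P ([set w | gap_leader (experts n) (scaled_score t) 0 (q ^~ w) j] `|` N))).
  rewrite le_measure ?inE//; [exact: measurable_selected|exact: measurableU|].
  move=> w /= Iw; have [Nw|Nw] := pselect (N w); [by right|left].
  have neq0 : argmin_in (experts n) (FPL_score k eta s (fun i => q i w) t) !=set0.
    by apply: contrapT => h; apply: Nw; apply: subN.
  have [_ /(_ neq0)] := I_sel tT w; rewrite Iw => -[_ jmin].
  split => // i ni _; have := jmin i ni.
  rewrite /FPL_score /scaled_score -(ler_pM2l eta0) !mulrDr.
  rewrite ![eta t * (_ / _)]mulrC !divfK ?gt_eqF//; lra.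
set L := [set w | _]; have LN : (P (L `|` N) <= P L + P N)%E by exact: measureU2.
by apply: le_trans LN _; rewrite [X in (_ + X)%E](N0 : P N = 0%E) adde0.
Qed.

(** With [l] the FPL loss and [g] the expected gap loss, [(1 - eta t) * l <= expR (- eta t) * l <=
    g], and [l <= 1] bounds the remaining [eta t * l]. *)
Lemma FPL_loss_le t : (1 <= t <= T)%N -> 0 < eta t ->
  (FPL_loss s I t <= (eta t)%:E + \int[P]_w gap_loss t w)%E.
Proof.
move=> tT eta0; have le_exp := FPL_loss_le_expR tT eta0.
have gap0 : (0 <= \int[P]_w gap_loss t w)%E.
  by apply: integral_ge0 => w _; exact: gap_loss_ge0.
have loss0 : (0 <= FPL_loss s I t)%E.
  rewrite FPL_lossE//; apply: integral_ge0 => w _; apply: nneseries_ge0 => j _ _.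
  by rewrite lee_fin mulr_ge0// patched_loss_ge0.
have loss1 : (FPL_loss s I t <= 1)%E.
  rewrite -(@probability_setT _ _ _ P) -[P setT]mul1e -integral_cst//.
  rewrite FPL_lossE//; apply: ge0_le_integral => //.
  - move=> w _; apply: nneseries_ge0 => j _ _.
    by rewrite lee_fin mulr_ge0// patched_loss_ge0.
  - apply: measurable_nneseries_indic => j; first exact: patched_loss_ge0.
    exact: measurable_selected.
  - move=> w _; rewrite (nneseries_indic (i := I t w))//; last first.
      by move=> j; exact: patched_loss_ge0.
    have [nI _] := I_sel tT w.
    by rewrite /patched_loss mem_set// lee_fin; case/andP: (s_01 tT nI).
case: (\int[P]_w gap_loss t w)%E le_exp gap0 => [g| |]//; last first.
  by move=> _ _; rewrite addey// leey.
case: (FPL_loss s I t) loss0 loss1 => [l| |]//.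
rewrite -EFinM -EFinD !lee_fin => l0 l1 lg g0.
have : expR (- eta t) * l <= g.
  have := ler_wpM2l (expR_ge0 (- eta t)) lg.
  by rewrite mulrA -expRD addNr expR0 mul1r.
have := ler_wpM2r l0 (expR_ge1Dx (- eta t)).
have := ler_wpM2l (ltW eta0) l1; lra.
Qed.

(** A sum is used in place of the supremum of the [q j - k j], as its expectation is computed
    termwise. *)
Definition total_excess (w : Omega) : \bar R :=
  (\sum_(j <oo)
     (if j \in experts n then Num.max (q j w - k j) 0 else 0)%:E)%E.

Lemma measurable_excess j :
  measurable_fun setT
    (fun w => if j \in experts n then Num.max (q j w - k j) 0 else 0).
Proof.
by case: (j \in experts n) => //; apply: measurable_maxr => //; exact: measurable_funB.
Qed.

Lemma excess_ge0 j w :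
  0 <= if j \in experts n then Num.max (q j w - k j) 0 else 0.
Proof. by case: ifP => // _; rewrite le_max lexx orbT. Qed.

Lemma total_excess_ge0 w : (0 <= total_excess w)%E.
Proof. by apply: nneseries_ge0 => j _ _; rewrite lee_fin excess_ge0. Qed.

Lemma measurable_total_excess : measurable_fun setT total_excess.
Proof.
apply: ge0_emeasurable_sum => j; first by move=> w _ _; rewrite lee_fin excess_ge0.
by move=> _; apply/measurable_EFinP; exact: measurable_excess.
Qed.

Lemma le_total_excess j w : experts n j ->
  ((q j w - k j)%:E <= total_excess w)%E.
Proof.
move=> nj; rewrite /total_excess (nneseriesD1 (n := j))//; last first.
  by move=> i _; rewrite lee_fin excess_ge0.
rewrite mem_set//; apply: (@le_trans _ _ (Num.max (q j w - k j) 0)%:E).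
  by rewrite lee_fin le_max lexx.
rewrite leeDl//; apply: nneseries_ge0 => i _ _.
by rewrite lee_fin excess_ge0.
Qed.

Hypothesis k_ge0 : forall i, experts n i -> 0 <= k i.

Lemma integral_total_excess_le1 : (\int[P]_w total_excess w <= 1)%E.
Proof.
rewrite integral_nneseries//; first last.
- by move=> j w _; rewrite lee_fin excess_ge0.
- by move=> j; apply/measurable_EFinP; exact: measurable_excess.
apply: le_trans kraft; rewrite -nneseries_patch; last by move=> j _; exact: expR_ge0.
apply: lee_nneseries => [j _ _|j _].
  by apply: integral_ge0 => w _; rewrite lee_fin excess_ge0.
case: ifPn => [/set_mem nj|nj]; last by rewrite integral0.
by rewrite expectation_exponential_excess; [|exact: q_tail|exact: k_ge0].
Qed.

Hypothesis eta_gt0 : forall t, (1 <= t <= T)%N -> 0 < eta t.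
Hypothesis eta0_ge0 : 0 <= eta 0.
Hypothesis eta_mono : forall t, (t < T)%N -> (eta t)^-1 <= (eta t.+1)^-1.
Hypothesis T_ge1 : (1 <= T)%N.

(** The perturbation of [i] stands on the left as a positive part, so that both sides are
    nonnegative and can be integrated without subtraction. *)
Lemma sum_gap_loss_le w i : experts n i -> 0 < q i w ->
  (\sum_(1 <= t < T.+1) gap_loss t w + (eta T)^-1%:E * (Num.max (q i w - 0) 0)%:E <=
   (loss_upto s T i + k i / eta T)%:E + (eta T)^-1%:E * total_excess w)%E.
Proof.
move=> ni qi0; have etaT : 0 < eta T by rewrite eta_gt0// T_ge1/=.
have : forall j, experts n j -> ((q j w - k j)%:E <= total_excess w)%E.
  by move=> j; exact: le_total_excess.
case: (total_excess w) (total_excess_ge0 w) => [M| |]//; last first.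
  move=> _ _; rewrite gt0_muley ?lte_fin ?invr_gt0//.
  by rewrite addey ?leey.
move=> _ qM.
pose g t := fine (gap_loss t w).
have gP t : (1 <= t <= T)%N -> gap_loss t w = (g t)%:E /\
    (g t = 0 \/ exists2 j, gap_leader (experts n)
      (fun j => eta t * loss_before s t j + k j) (eta t) (q ^~ w) j &
      g t = s t j).
  move=> tT.
  have [[j lead]|nolead] := pselect (exists j,
      gap_leader (experts n) (scaled_score t) (eta t) (q ^~ w) j).
    have gE : gap_loss t w = (s t j)%:E.
      rewrite /gap_loss (nneseries_indic (i := j))//.
      - by rewrite /patched_loss mem_set//; case: lead.
      - by move=> m; exact: patched_loss_ge0.
      - by move=> m leadm; apply: gap_leader_inj leadm lead; exact: eta_gt0.
    by rewrite /g gE; split => //; right; exists j.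
  have gE : gap_loss t w = 0%E.
    by rewrite /gap_loss nneseries_indic0// => j lead; apply: nolead; exists j.
  by rewrite /g gE; split => //; left.
have -> : (\sum_(1 <= t < T.+1) gap_loss t w = (\sum_(1 <= t < T.+1) g t)%:E)%E.
  rewrite -sumEFin big_nat [RHS]big_nat; apply: eq_bigr => t /andP[t1 tT].
  by have [|->] := gP t; rewrite ?t1.
have xM j : experts n j -> q j w - k j <= M by move=> /qM; rewrite lee_fin.
have := gap_leader_regret s_01 eta_gt0 eta0_ge0 eta_mono xM
  (fun t tT => (gP t tT).2) (leqnn _) ni.
rewrite -!EFinM -!EFinD lee_fin.
rewrite subr0 max_l ?(ltW qi0)// !mulrDl mulNr; lra.
Qed.

Lemma sum_integral_gap_loss_le i : experts n i ->
  (\sum_(1 <= t < T.+1) \int[P]_w gap_loss t w <=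
   (loss_upto s T i + k i / eta T)%:E)%E.
Proof.
move=> ni; have etaT : 0 < eta T by rewrite eta_gt0// T_ge1/=.
have r0 : 0 <= (eta T)^-1 by rewrite invr_ge0 ltW.
have mq0 : measurable_fun setT (fun w => (Num.max (q i w - 0) 0)%:E).
  by apply/measurable_EFinP/measurable_maxr => //; exact: measurable_funB.
have q0 w : (0 <= (Num.max (q i w - 0) 0)%:E)%E by rewrite lee_fin le_max lexx orbT.
have mgap : measurable_fun setT (fun w => \sum_(1 <= t < T.+1) gap_loss t w)%E.
  under eq_fun do rewrite big_nat big_mkcond.
  apply: emeasurable_sum => t.
  by case: (boolP (1 <= t < T.+1)%N) => // tT; exact: measurable_gap_loss.
have gap0 w : (0 <= \sum_(1 <= t < T.+1) gap_loss t w)%E.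
  by rewrite big_nat sume_ge0// => t tT; exact: gap_loss_ge0.
have L0 : 0 <= loss_upto s T i + k i / eta T.
  rewrite addr_ge0 ?mulr_ge0 ?k_ge0// /loss_upto big_nat sumr_ge0// => t tT.
  by case/andP: (s_01 tT ni).
have key : (\int[P]_w (\sum_(1 <= t < T.+1) gap_loss t w +
      (eta T)^-1%:E * (Num.max (q i w - 0) 0)%:E) <=
    \int[P]_w ((loss_upto s T i + k i / eta T)%:E +
      (eta T)^-1%:E * total_excess w))%E.
  apply: ae_ge0_le_integral => //.
  - by move=> w _; rewrite adde_ge0// mule_ge0.
  - by apply: emeasurable_funD => //; exact: measurable_funeM.
  - by move=> w _; rewrite adde_ge0// mule_ge0// total_excess_ge0.
  - apply: emeasurable_funD => //; apply: measurable_funeM.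
    exact: measurable_total_excess.
  (* The pointwise bound requires [0 < q i w], which fails only on a null event by the tail at
     [0]. *)
  have mpos : measurable [set w | 0 < q i w] by exact: measurable_lt_set.
  have Pneg : P (~` [set w | 0 < q i w]) = 0%E.
    by rewrite probability_setC// q_tail// oppr0 expR0 subee.
  exists (~` [set w | 0 < q i w]); split.
  - exact: measurableC.
  - exact: Pneg.
  - by move=> w h qi; apply: h => _; exact: sum_gap_loss_le.
move: key; rewrite ge0_integralD//; last 2 first.
- by move=> w _; rewrite mule_ge0.
- exact: measurable_funeM.
rewrite ge0_integralD//; last 2 first.
- by move=> w _; rewrite mule_ge0// total_excess_ge0.
- by apply: measurable_funeM; exact: measurable_total_excess.
rewrite !ge0_integralZl_EFin//; [|by move=> w _; exact: total_excess_ge0|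
  exact: measurable_total_excess].
rewrite expectation_exponential_excess//; last exact: q_tail.
rewrite oppr0 expR0 mule1 integral_cst//= probability_setT mule1.
have -> : (\int[P]_w (\sum_(1 <= t < T.+1) gap_loss t w) =
    \sum_(1 <= t < T.+1) \int[P]_w gap_loss t w)%E.
  under eq_integral do rewrite big_nat big_mkcond.
  rewrite ge0_integral_sum//; last 2 first.
  - by move=> t; case: (boolP (1 <= t < T.+1)%N) => // tT; exact: measurable_gap_loss.
  - by move=> t w _; case: ifP => // tT; exact: gap_loss_ge0.
  rewrite [RHS]big_nat [RHS]big_mkcond; apply: eq_bigr => t _.
  by case: ifP => // _; rewrite integral0.
(* The perturbation of [i] has mean [1] and the total excess has mean at most [1], so the two terms
   weighted by [(eta T)^-1] cancel. *)
move=> key; rewrite -(leeD2rE (x := (eta T)^-1%:E))//.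
apply: le_trans key _; rewrite leeD2l//.
by rewrite -[leRHS]mule1 lee_wpmul2l// integral_total_excess_le1.
Qed.

Lemma FPL_regret i : experts n i ->
  (FPL_loss_upto s I T <=
   (loss_upto s T i + k i / eta T + \sum_(1 <= t < T.+1) eta t)%:E)%E.
Proof.
move=> ni; rewrite EFinD addeC.
apply: (@le_trans _ _ ((\sum_(1 <= t < T.+1) (eta t)%:E) +
    \sum_(1 <= t < T.+1) \int[P]_w gap_loss t w)%E).
  rewrite -big_split/= /FPL_loss_upto [leLHS]big_nat [leRHS]big_nat.
  apply: lee_sum => t tT; apply: FPL_loss_le => //; exact: eta_gt0.
by rewrite sumEFin leeD2l// sum_integral_gap_loss_le.
Qed.

End FPL_regret_bound.

(** * Learning rates proportional to the inverse square root of time *)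

Lemma sum_inv_sqrt_le (R : realType) (T : nat) :
  \sum_(1 <= t < T.+1) (Num.sqrt (t%:R : R))^-1 <= 2 * Num.sqrt T%:R.
Proof.
elim: T => [|T IH]; first by rewrite big_nil mulr_ge0 ?sqrtr_ge0.
rewrite big_nat_recr//=.
set a := Num.sqrt T.+1%:R; set b := Num.sqrt T%:R in IH *.
have a0 : 0 < a by rewrite sqrtr_gt0 ltr0n.
have ab : a ^+ 2 = b ^+ 2 + 1 by rewrite !sqr_sqrtr ?ler0n// natr1.
suff : a^-1 <= 2 * a - 2 * b by lra.
rewrite -[a^-1]mul1r ler_pdivrMr//.
(* Indeed [2 * a * (a - b) = (a - b) ^+ 2 + a ^+ 2 - b ^+ 2 >= 1]. *)
by have := sqr_ge0 (a - b); nra.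
Qed.

(** Covers both parts of the theorem, with [c = 1] and [c = Num.sqrt (K / 2)]. *)
Lemma FPL_regret_sqrt (R : realType) (d : measure_display)
    (Omega : measurableType d) (P : probability Omega R)
    (n : option nat) (k eta : nat -> R) (c : R) (T : nat)
    (s : nat -> nat -> R) (q : nat -> {RV P >-> R}) (I : nat -> {RV P >-> nat}) :
  (forall i, experts n i -> 0 <= k i) ->
  (\esum_(i in experts n) (expR (- k i))%:E <= 1)%E -> (1 <= T)%N ->
  (forall t i, (1 <= t <= T)%N -> experts n i -> 0 <= s t i <= 1) ->
  exponential_perturbation n q -> 0 < c ->
  (forall t, eta t = c / Num.sqrt t%:R) -> FPL_selection n k eta s q T I ->
  forall i, experts n i ->
    (FPL_loss_upto s I T <=
     (loss_upto s T i + Num.sqrt T%:R * (k i / c + 2 * c))%:E)%E.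
Proof.
move=> k0 kraft T1 s01 [indep qexp] c0 etaE Isel i ni.
have tail j : experts n j -> forall x : R, 0 <= x ->
    P [set w | x < q j w] = (expR (- x))%:E.
  by move=> nj; apply: exponential_tail; exact: qexp.
have eta_gt0 t : (1 <= t <= T)%N -> 0 < eta t.
  by case/andP => t1 _; rewrite etaE divr_gt0// sqrtr_gt0 ltr0n.
(* Division by zero gives [eta 0 = 0], whose inverse is again [0]; monotonicity of the inverses thus
   includes [t = 0]. *)
have eta0 : 0 <= eta 0 by rewrite etaE divr_ge0 ?sqrtr_ge0// ltW.
have eta_mono t : (t < T)%N -> (eta t)^-1 <= (eta t.+1)^-1.
  move=> _; rewrite !etaE !invf_div ler_wpM2r ?invr_ge0 ?(ltW c0)//.
  by rewrite ler_wsqrtr// ler_nat.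
apply: le_trans (FPL_regret kraft s01 indep tail Isel k0 eta_gt0 eta0 eta_mono T1 ni) _.
rewrite lee_fin -addrA lerD2l etaE mulrDr lerD//.
  by rewrite invf_div mulrCA.
under eq_bigr do rewrite etaE.
rewrite -mulr_sumr; have := ler_wpM2l (ltW c0) (sum_inv_sqrt_le R T); lra.
Qed.

Theorem theorem6 (R : realType) (d : measure_display)
    (Omega : measurableType d) (P : probability Omega R)
    (n : option nat) (k : nat -> R) (T : nat) (s : nat -> nat -> R)
    (q : nat -> {RV P >-> R})
    (k_ge0 : forall i, experts n i -> 0 <= k i)
    (kraft : (\esum_(i in experts n) (expR (- k i))%:E <= 1)%E)
    (T_ge1 : (1 <= T)%N)
    (s_01 : forall t i, (1 <= t <= T)%N -> experts n i -> 0 <= s t i <= 1)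
    (q_exp : exponential_perturbation n q) :
  (forall I : nat -> {RV P >-> nat},
     FPL_selection n k (fun t => 1 / Num.sqrt t%:R) s q T I ->
     forall i, experts n i ->
       (FPL_loss_upto s I T <=
          (loss_upto s T i + Num.sqrt T%:R * (k i + 2))%:E)%E)
  /\
  (forall K : R, 0 < K -> (forall i, experts n i -> k i <= K) ->
     forall I : nat -> {RV P >-> nat},
     FPL_selection n k (fun t => Num.sqrt (K / (2 * t%:R))) s q T I ->
     forall i, experts n i ->
       (FPL_loss_upto s I T <=
          (loss_upto s T i + 2 * Num.sqrt (2 * T%:R * K))%:E)%E).
Proof.
split=> [I Isel i ni|K K0 kK I Isel i ni].
  have := FPL_regret_sqrt k_ge0 kraft T_ge1 s_01 q_exp ltr01 (fun=> erefl) Isel ni.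
  by rewrite divr1 mulr1.
(* This [c] balances the two terms: [K / c = 2 * c], for a total of [4 * c * Num.sqrt T%:R]. *)
pose c := Num.sqrt (K / 2).
have c0 : 0 < c by rewrite sqrtr_gt0 divr_gt0.
have cc : K = 2 * c ^+ 2 by rewrite sqr_sqrtr ?divr_ge0 ?(ltW K0)//; field.
have etaE t : Num.sqrt (K / (2 * t%:R)) = c / Num.sqrt t%:R.
  by rewrite invfM mulrA sqrtrM ?divr_ge0 ?(ltW K0)// sqrtrV.
apply: le_trans (FPL_regret_sqrt k_ge0 kraft T_ge1 s_01 q_exp c0 etaE Isel ni) _.
rewrite lee_fin lerD2l.
have -> : Num.sqrt (2 * T%:R * K) = Num.sqrt T%:R * (2 * c).
  have -> : 2 * T%:R * K = T%:R * (2 * c) ^+ 2 by rewrite cc; ring.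
  by rewrite sqrtrM// sqrtr_sqr ger0_norm// mulr_ge0// ltW.
rewrite mulrCA ler_wpM2l ?sqrtr_ge0//.
suff : k i / c <= 2 * c by lra.
by rewrite ler_pdivrMr// -mulrA -expr2 -cc kK.
Qed.
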